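(* Let $A$ be a positive information algebra, let $L$ be a chain (totally ordered set) disjoint from $A$, and let $S=A\uplus_{\mathrm{ord}}L$ be the overflow semiring. Let $f=\sum_{n=0}^\infty a_nX^n\in S[[X]]$ be a formal power series with $a_0=\lambda\in L$. Then $f^2=f$ if and only if for every $n\geq 1$: (1) $a_n\in\{0\}\cup\{x\in L: x\geq\lambda\}$; (2) $a_n\geq\sup_{1\leq i\leq n-1}a_ia_{n-i}$ whenever $a_n\neq 0$; (3) $\sup_{1\leq i\leq n-1}a_ia_{n-i}=0$ whenever $a_n=0$.
   Context: All semirings are commutative: $(S,+,0)$ and $(S,\cdot,1)$ are commutative monoids, $1\neq 0$, multiplication distributes over addition, and $0$ is absorbing. A semiring is zerosumfree if $a+b=0$ implies $a=b=0$, and entire if $ab=0$ implies $a=0$ or $b=0$; an information algebra is a zerosumfree entire semiring. A positive information algebra is an information algebra with a partial order $\leq$ compatible with $+$ and $\cdot$ (i.e. $x\leq y$ implies $x+z\leq y+z$ and $xz\leq yz$) and having $0$ as least element. Overflow semiring $S=A\uplus_{\mathrm{ord}}L$: for a positive information algebra $A$ and a join-semilattice $L$ disjoint from $A$, $S=A\cup L$ with the order extending those of $A$ and $L$ by $a\leq\ell$ for all $a\in A,\ell\in L$ (and never $\ell\leq a$), and operations: $x+y=x+_Ay$ if $x,y\in A$, $x+y=\sup\{x,y\}$ otherwise; $xy=x\cdot_Ay$ if $x,y\in A\setminus\{0\}$, $xy=0$ if $x=0$ or $y=0$, and $xy=\sup\{x,y\}$ otherwise. With these, $S$ is a positive information algebra.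 $S[[X]]$ carries the usual coefficientwise addition and convolution product. Suprema are taken in $(S,\leq)$, and the empty supremum (case $n=1$) is the least element $0$. *)

(* Defs.v *)
From HB Require Import structures.
From mathcomp Require Import all_boot all_order all_algebra.
From mathcomp Require Import boolp classical_sets.

Set Implicit Arguments.
Unset Strict Implicit.
Unset Printing Implicit Defensive.

Import Order.TTheory GRing.Theory.

Local Open Scope ring_scope.

HB.mixin Record isInformationAlgebra S of GRing.ComNzSemiRing S := {
  zerosumfree : forall a b : S, a + b = 0 -> a = 0 /\ b = 0;
  entire : forall a b : S, a * b = 0 -> a = 0 \/ b = 0
}.

#[short(type="informationAlgebraType")]
HB.structure Definition InformationAlgebra :=
  { S of GRing.ComNzSemiRing S & isInformationAlgebra S }.

(* pos_le is a field of its own: a structure joining Order.POrder with a semiring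
   would compete with Num.POrderedZmodule (which requires opposites), and
   Hierarchy-Builder rejects it. *)
HB.mixin Record isPositiveInformationAlgebra S of InformationAlgebra S := {
  pos_le : rel S;
  pos_le_refl : reflexive pos_le;
  pos_le_anti : antisymmetric pos_le;
  pos_le_trans : transitive pos_le;
  pos_leD2r : forall z x y : S, pos_le x y -> pos_le (x + z) (y + z);
  pos_leM2r : forall z x y : S, pos_le x y -> pos_le (x * z) (y * z);
  pos_le0 : forall x : S, pos_le 0 x
}.

#[short(type="posInformationAlgebraType")]
HB.structure Definition PosInformationAlgebra :=
  { S of InformationAlgebra S & isPositiveInformationAlgebra S }.

Inductive overflow (A L : Type) := Base of A | Over of L.
Arguments Base {A L} _.
Arguments Over {A L} _.

Fact overflow_display (d : Order.disp_t) : Order.disp_t.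
Proof. exact: Order.Disp tt tt. Qed.

Section OverflowChoice.
Variables A L : choiceType.

Definition overflow_sum (x : overflow A L) : A + L :=
  match x with Base a => inl a | Over l => inr l end.

Definition sum_overflow (x : A + L) : overflow A L :=
  match x with inl a => Base a | inr l => Over l end.

Lemma overflow_sumK : cancel overflow_sum sum_overflow.
Proof. by case. Qed.

HB.instance Definition _ := Choice.copy (overflow A L) (can_type overflow_sumK).

End OverflowChoice.

Section OverflowSemiring.
Variables (d : Order.disp_t).
Variables (A : posInformationAlgebraType) (L : joinSemilatticeType d).
Local Notation S := (overflow A L).

Definition overflow_le (x y : S) : bool :=
  match x, y with
  | Base a, Base b => pos_le a b
  | Base _, Over _ => true
  | Over _, Base _ => false
  | Over l, Over m => (l <= m)%O
  end.

Lemma overflow_le_refl : reflexive overflow_le.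
Proof. by case=> x /=; rewrite ?pos_le_refl. Qed.

Lemma overflow_le_anti : antisymmetric overflow_le.
Proof. by move=> [x|x] [y|y] //= => [/pos_le_anti|/le_anti] ->. Qed.

Lemma overflow_le_trans : transitive overflow_le.
Proof. by move=> [y|y] [x|x] [z|z] //=; [exact: pos_le_trans|exact: le_trans]. Qed.

HB.instance Definition _ := Order.Le_isPOrder.Build (overflow_display d) S
  overflow_le_refl overflow_le_anti overflow_le_trans.

(* The clauses with an argument in L compute sup {x, y} in S; see
   overflow_add_sup and overflow_mul_sup. *)
Definition overflow_add (x y : S) : S :=
  match x, y with
  | Base a, Base b => Base (a + b)
  | Base _, Over l => Over l
  | Over l, Base _ => Over l
  | Over l, Over m => Over (l `|` m)%O
  end.

Definition overflow_mul (x y : S) : S :=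
  match x, y with
  | Base a, Base b => Base (a * b)
  | Base a, Over l => if a == 0 then Base 0 else Over l
  | Over l, Base a => if a == 0 then Base 0 else Over l
  | Over l, Over m => Over (l `|` m)%O
  end.

Lemma info_add_eq0 (a b : A) : (a + b == 0) = (a == 0) && (b == 0).
Proof.
apply/eqP/andP => [/zerosumfree[-> ->] //|[/eqP -> /eqP ->]].
by rewrite addr0.
Qed.

Lemma info_mul_eq0 (a b : A) : (a * b == 0) = (a == 0) || (b == 0).
Proof.
apply/eqP/orP => [/entire[->|->]|[/eqP ->|/eqP ->]].
- by left.
- by right.
- by rewrite mul0r.
- by rewrite mulr0.
Qed.

Lemma overflow_addA : associative overflow_add.
Proof. by move=> [x|x] [y|y] [z|z] //=; rewrite (addrA, joinA). Qed.

Lemma overflow_addC : commutative overflow_add.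
Proof. by move=> [x|x] [y|y] //=; rewrite (addrC, joinC). Qed.

Lemma overflow_add0 : left_id (Base 0) overflow_add.
Proof. by move=> [x|x] //=; rewrite add0r. Qed.

HB.instance Definition _ := GRing.isNmodule.Build S
  overflow_addA overflow_addC overflow_add0.

Lemma overflow_mulC : commutative overflow_mul.
Proof. by move=> [x|x] [y|y] //=; rewrite (mulrC, joinC). Qed.

Lemma overflow_mulA : associative overflow_mul.
Proof.
move=> [x|x] [y|y] [z|z] /=; rewrite ?mulrA ?joinA // ?info_mul_eq0.
- by case: (eqVneq y 0) => [_|_] /=; rewrite ?orbT ?orbF ?mulr0.
- case: (eqVneq x 0) => [->|x0]; case: (eqVneq z 0) => [->|z0] //=;
    by rewrite ?eqxx ?mul0r ?mulr0 ?(negPf x0) ?(negPf z0).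
- by case: (eqVneq x 0) => [_|x0] /=; rewrite ?eqxx ?(negPf x0).
- by case: (eqVneq y 0) => [_|_] /=; rewrite ?mul0r ?eqxx.
- by case: (eqVneq y 0) => [_|_] /=; rewrite ?eqxx.
- by case: (eqVneq z 0) => [_|_] /=; rewrite ?eqxx.
Qed.

Lemma overflow_mul1 : left_id (Base 1) overflow_mul.
Proof. by move=> [x|x] /=; rewrite ?mul1r ?oner_eq0. Qed.

Lemma overflow_mulD : left_distributive overflow_mul overflow_add.
Proof.
move=> [x|x] [y|y] [z|z] //=; rewrite ?mulrDl //.
- rewrite info_add_eq0; case: eqP => _; case: eqP => _ //=.
    by rewrite addr0.
  by rewrite joinxx.
- by case: eqP => [->|//]; rewrite mulr0 addr0.
- by case: eqP => _ //=; rewrite joinCA joinxx.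
- by case: eqP => [->|//]; rewrite mulr0 /= addr0.
- by case: eqP => _ //=; rewrite -joinA joinxx.
- by case: eqP => _ //=; rewrite addr0.
- by rewrite joinACA joinxx.
Qed.

Lemma overflow_mul0 : left_zero (Base 0) overflow_mul.
Proof. by move=> [x|x] /=; rewrite ?mul0r ?eqxx. Qed.

Lemma overflow_one_neq0 : Base 1 != 0 :> S.
Proof. by apply/eqP => -[] /eqP; rewrite oner_eq0. Qed.

HB.instance Definition _ := GRing.Nmodule_isComNzSemiRing.Build S
  overflow_mulA overflow_mulC overflow_mul1 overflow_mulD overflow_mul0
  overflow_one_neq0.

Lemma overflow_zerosumfree (x y : S) : x + y = 0 -> x = 0 /\ y = 0.
Proof. by case: x y => [a|a] [b|b] // [] /zerosumfree[-> ->]. Qed.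

Lemma overflow_entire (x y : S) : x * y = 0 -> x = 0 \/ y = 0.
Proof.
case: x y => [a|a] [b|b] //.
- by case=> /entire[->|->]; [left|right].
- by rewrite {1}/GRing.mul /=; case: eqP => [-> _|//]; left.
- by rewrite {1}/GRing.mul /=; case: eqP => [-> _|//]; right.
Qed.

HB.instance Definition _ :=
  isInformationAlgebra.Build S overflow_zerosumfree overflow_entire.

Lemma overflow_leD2r (z x y : S) :
  overflow_le x y -> overflow_le (x + z) (y + z).
Proof.
case: x y z => [a|a] [b|b] [c|c] //=.
- exact: pos_leD2r.
- by rewrite leUr.
- by move=> ab; rewrite leUx leUr (le_trans ab) ?leUl.
Qed.

Lemma overflow_leM2r (z x y : S) :
  overflow_le x y -> overflow_le (x * z) (y * z).
Proof.
case: x y z => [a|a] [b|b] [c|c]; rewrite /GRing.mul //=.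
- exact: pos_leM2r.
- case: (eqVneq a 0) => [_|a0]; case: (eqVneq b 0) => [b0|_] //= ab.
  + by rewrite pos_le_refl.
  + by case/eqP: a0; apply/pos_le_anti; rewrite pos_le0 andbT -b0.
- by case: eqP => [->|//]; rewrite mulr0 pos_le_refl.
- by case: eqP => // _ _; rewrite /= leUr.
- by case: eqP => //= _ _; rewrite pos_le_refl.
- by move=> ab; rewrite leUx leUr (le_trans ab) ?leUl.
Qed.

Lemma overflow_le0 (x : S) : overflow_le 0 x.
Proof. by case: x => [a|a] //; exact: pos_le0. Qed.

HB.instance Definition _ := isPositiveInformationAlgebra.Build S
  overflow_le_refl overflow_le_anti overflow_le_trans
  overflow_leD2r overflow_leM2r overflow_le0.

Lemma overflow_leE (x y : S) : (x <= y)%O = pos_le x y.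
Proof. by []. Qed.

Local Open Scope classical_set_scope.

Lemma overflow_sup (x y : S) :
  (forall a b : A, ~ (x = Base a /\ y = Base b)) ->
  supremums [set x; y] (overflow_add x y).
Proof.
move=> nAA; split.
- move=> _ [->|->].
  + case: x y nAA => [a|a] [b|b] nAA; rewrite /Order.le //=.
    * by case: (nAA a b).
    * by rewrite leUl.
  + case: x y nAA => [a|a] [b|b] nAA; rewrite /Order.le //=.
    * by case: (nAA a b).
    * by rewrite leUr.
- move=> z uz; have xz := uz x (or_introl erefl); have yz := uz y (or_intror erefl).
  case: x y z nAA xz yz {uz} => [a|a] [b|b] [c|c] nAA; rewrite /Order.le //=.
  + by case: (nAA a b).
  + by rewrite leUx => -> ->.
Qed.

Lemma overflow_add_sup (x y : S) :
  (forall a b : A, ~ (x = Base a /\ y = Base b)) ->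
  supremums [set x; y] (x + y).
Proof. exact: overflow_sup. Qed.

Lemma overflow_mul_sup (x y : S) : x != 0 -> y != 0 ->
  (forall a b : A, ~ (x = Base a /\ y = Base b)) ->
  supremums [set x; y] (x * y).
Proof.
move=> x0 y0 nAA; suff -> : x * y = overflow_add x y by exact: overflow_sup.
case: x y x0 y0 nAA => [a|a] [b|b] x0 y0 nAA //.
- by case: (nAA a b).
- have /negPf c0 : a != 0 by apply: contraNneq x0 => ->.
  by rewrite /GRing.mul /= c0.
- have /negPf c0 : b != 0 by apply: contraNneq y0 => ->.
  by rewrite /GRing.mul /= c0.
Qed.

End OverflowSemiring.

Record powerSeries (S : Type) := PowerSeries { coefs :> nat -> S }.

Section PowerSeriesSemiring.
Variable S : comNzSemiRingType.
Implicit Types f g h : powerSeries S.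

HB.instance Definition _ := [isNew for @coefs S].
HB.instance Definition _ := [Choice of powerSeries S by <:].

Lemma powerSeriesP f g : (forall n, f n = g n) <-> f = g.
Proof.
by split=> [fg|-> //]; case: f g fg => [f] [g] /= fg; congr PowerSeries; apply/funext.
Qed.

Definition ps_zero : powerSeries S := PowerSeries (fun=> 0).

Definition ps_one : powerSeries S := PowerSeries (fun n => (n == 0%N)%:R).

Definition ps_add f g : powerSeries S := PowerSeries (fun n => f n + g n).

Definition ps_mul f g : powerSeries S :=
  PowerSeries (fun n => \sum_(i < n.+1) f i * g (n - i)%N).

Lemma ps_addA : associative ps_add.
Proof. by move=> f g h; apply/powerSeriesP => n; exact: addrA. Qed.

Lemma ps_addC : commutative ps_add.
Proof. by move=> f g; apply/powerSeriesP => n; exact: addrC. Qed.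

Lemma ps_add0 : left_id ps_zero ps_add.
Proof. by move=> f; apply/powerSeriesP => n; exact: add0r. Qed.

HB.instance Definition _ := GRing.isNmodule.Build (powerSeries S)
  ps_addA ps_addC ps_add0.

Let trunc N f : {poly S} := \poly_(i < N) f i.

Let coef_trunc_mul N f g n : (n < N)%N ->
  (trunc N f * trunc N g)`_n = ps_mul f g n.
Proof.
move=> nN; rewrite coefM; apply: eq_bigr => i _.
by rewrite !coef_poly (leq_trans (ltn_ord i)) // (leq_ltn_trans (leq_subr _ _)).
Qed.

Lemma ps_mulC : commutative ps_mul.
Proof.
by move=> f g; apply/powerSeriesP => n; rewrite -!(@coef_trunc_mul n.+1) // mulrC.
Qed.

Lemma ps_mulA : associative ps_mul.
Proof.
move=> f g h; apply/powerSeriesP => n.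
transitivity ((trunc n.+1 f * (trunc n.+1 g * trunc n.+1 h))`_n).
  rewrite coefM; apply: eq_bigr => i _.
  by rewrite coef_poly ltn_ord coef_trunc_mul // ltnS leq_subr.
rewrite mulrA coefM; apply: eq_bigr => i _.
by rewrite coef_trunc_mul // coef_poly ltnS leq_subr.
Qed.

Lemma ps_mul1 : left_id ps_one ps_mul.
Proof.
move=> f; apply/powerSeriesP => n.
by rewrite /= big_ord_recl /= mul1r subn0 big1 ?addr0 // => i _; rewrite mul0r.
Qed.

Lemma ps_mulD : left_distributive ps_mul ps_add.
Proof.
move=> f g h; apply/powerSeriesP => n /=.
by rewrite -big_split; apply: eq_bigr => i _; rewrite mulrDl.
Qed.

Lemma ps_mul0 : left_zero ps_zero ps_mul.
Proof.
by move=> f; apply/powerSeriesP => n /=; rewrite big1 // => i _; rewrite mul0r.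
Qed.

Lemma ps_one_neq0 : ps_one != 0.
Proof.
by apply/eqP => /powerSeriesP /(_ 0%N) /= /eqP; rewrite (negPf (oner_neq0 S)).
Qed.

HB.instance Definition _ := GRing.Nmodule_isComNzSemiRing.Build (powerSeries S)
  ps_mulA ps_mulC ps_mul1 ps_mulD ps_mul0 ps_one_neq0.

Lemma ps_coefM f g n : (f * g) n = \sum_(i < n.+1) f i * g (n - i)%N.
Proof. by []. Qed.

End PowerSeriesSemiring.

(* Main.v *)
(** Write [T n] for the sum of the [f i * f (n - i)] over [1 <= i <= n - 1].
Since [lam * f n] is [0] or lies in [L], it is additively idempotent, so
[f ^+ 2 = f] says that [f n = lam * f n + T n] for all [n >= 1]. A nonzero
[f n] in [A] would make the right-hand side an element of [L], so every
coefficient lies in [{0} \cup L]. On this subsemiring addition is the binary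
join, hence [T n] is the supremum of its terms, and the three conditions spell
out the equation. *)

Require Import Defs.
From mathcomp Require Import all_boot all_order all_algebra.
From mathcomp Require Import boolp classical_sets.

Import Order.TTheory GRing.Theory.
Local Open Scope classical_set_scope.
Local Open Scope ring_scope.

Section ZeroOrOver.
Context {d : Order.disp_t} {A : posInformationAlgebraType}
  {L : joinSemilatticeType d}.
Local Notation S := (overflow A L).

Definition zero_or_over (x : S) : bool :=
  if x is Base a then a == 0 else true.

Lemma zero_or_over0 : zero_or_over 0.
Proof. exact: eqxx. Qed.

Lemma zero_or_overD (x y : S) :
  zero_or_over x -> zero_or_over y -> zero_or_over (x + y).
Proof.
by case: x y => [a|a] [b|b] //= /eqP-> /eqP->; rewrite addr0.
Qed.

Lemma zero_or_overM (x y : S) :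
  zero_or_over x -> zero_or_over y -> zero_or_over (x * y).
Proof.
case: x y => [a|a] [b|b] //= => [/eqP-> _|/eqP-> _|_ /eqP->].
- by rewrite mul0r.
- by rewrite -[Base 0]/(0 : S) mul0r zero_or_over0.
- by rewrite -[Base 0]/(0 : S) mulr0 zero_or_over0.
Qed.

Lemma zero_or_over_sum (I : Type) (r : seq I) (P : pred I) (F : I -> S) :
  (forall i, P i -> zero_or_over (F i)) -> zero_or_over (\sum_(i <- r | P i) F i).
Proof.
move=> zF; apply: (big_ind (fun x => is_true (zero_or_over x))) => //.
- exact: zero_or_over0.
- exact: zero_or_overD.
Qed.

Lemma zero_or_overDxx (x : S) : zero_or_over x -> x + x = x.
Proof.
case: x => [a /eqP->|l _]; rewrite /GRing.add /= ?addr0 //.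
by rewrite joinxx.
Qed.

Lemma overflow_le0x (x : S) : ((0 : S) <= x)%O.
Proof. exact: overflow_le0. Qed.

(** On {0} and [L] the sum is the binary join. Two nonzero elements of [A] may add up to more than a
    common upper bound. *)
Lemma overflow_addx_le (x y z : S) : zero_or_over x -> zero_or_over y ->
  ((x + y : S) <= z)%O = (x <= z)%O && (y <= z)%O.
Proof.
case: x y z => [a|a] [b|b] [c|c] //=; rewrite /Order.le //=.
- by move=> /eqP-> /eqP->; rewrite addr0 andbb.
- by move=> /eqP-> _; rewrite pos_le0.
- by rewrite andbT.
- by rewrite leUx.
Qed.

Lemma overflow_sum_le (I : eqType) (r : seq I) (F : I -> S) (z : S) :
  (forall i, i \in r -> zero_or_over (F i)) ->
  ((\sum_(i <- r) F i : S) <= z)%O = all (fun i => (F i <= z)%O) r.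
Proof.
elim: r => [|i r IH] zF; first by rewrite big_nil overflow_le0x.
have zFr j : j \in r -> zero_or_over (F j).
  by move=> jr; apply: zF; rewrite inE jr orbT.
rewrite big_cons overflow_addx_le ?IH //; first by apply: zF; rewrite inE eqxx.
by rewrite big_seq; apply: zero_or_over_sum.
Qed.

(** Iterating the binary join gives the least upper bound. An empty range has sum 0, the least
    element, which matches the convention for the empty supremum. *)
Lemma overflow_sum_sup (m n : nat) (F : nat -> S) :
  (forall i, (m <= i < n)%N -> zero_or_over (F i)) ->
  supremums [set F i | i in [set i | (m <= i < n)%N]] (\sum_(m <= i < n) F i).
Proof.
move=> zF.
have leP z : ((\sum_(m <= i < n) F i : S) <= z)%O <->
    forall i, (m <= i < n)%N -> (F i <= z)%O.
  rewrite overflow_sum_le => [|i]; last by rewrite mem_index_iota; exact: zF.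
  split=> [/allP Fz i|Fz].
    by rewrite -mem_index_iota; exact: Fz.
  by apply/allP => i; rewrite mem_index_iota; exact: Fz.
split.
- by move=> _ [i mn <-]; apply: (iffLR (leP _)).
- by move=> z uz; apply/leP => i mn; apply: uz; exists i.
Qed.

(** For nonzero [x], product and sum with an element of [L] are both the supremum of the two. *)
Lemma overflow_mul_Over (l : L) (x : S) :
  (Over l : S) * x = if x == 0 then 0 else Over l + x.
Proof.
by case: x.
Qed.

Lemma zero_or_over_mul_Over (l : L) (x : S) :
  zero_or_over ((Over l : S) * x).
Proof.
by rewrite overflow_mul_Over; case: eqP => _; [exact: zero_or_over0|case: x].
Qed.

End ZeroOrOver.

(** As [n >= 1], the end terms [i = 0] and [i = n] of the convolution are distinct, and they agree
    by commutativity. *)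
Lemma ps_sqr_coef (S : comNzSemiRingType) (f : powerSeries S) (n : nat) :
  (1 <= n)%N ->
  (f ^+ 2) n = f 0%N * f n + f 0%N * f n + \sum_(1 <= i < n) f i * f (n - i)%N.
Proof.
case: n => // n _; rewrite expr2 ps_coefM.
rewrite -(big_mkord xpredT (fun i => f i * f (n.+1 - i)%N)).
rewrite big_nat_recr //= big_ltn // subn0 subnn.
by rewrite (mulrC (f n.+1)) addrAC.
Qed.

Section Idempotent.
Context {d : Order.disp_t} {A : posInformationAlgebraType}
  {L : joinSemilatticeType d}.
Local Notation S := (overflow A L).
Variables (f : powerSeries S) (lam : L).
Hypothesis f0 : f 0%N = Over lam.

Lemma ps_idempotentE : f ^+ 2 = f <->
  forall n, (1 <= n)%N ->
    f n = (Over lam : S) * f n + \sum_(1 <= i < n) f i * f (n - i)%N.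
Proof.
have sqrE n : (1 <= n)%N ->
    (f ^+ 2) n = (Over lam : S) * f n + \sum_(1 <= i < n) f i * f (n - i)%N.
  move=> n1; rewrite ps_sqr_coef // f0 zero_or_overDxx //.
  exact: zero_or_over_mul_Over.
split=> [ff n n1|fE]; first by rewrite -sqrE // ff.
apply/powerSeriesP => -[|n]; last by rewrite sqrE // -fE.
(* The constant coefficient imposes no condition, since [lam] joined with itself is [lam]. *)
by rewrite expr2 ps_coefM big_ord_recl big_ord0 addr0 subn0 f0 /GRing.mul /= joinxx.
Qed.

(** Here [t] is arbitrary, so the lemma applies before anything is known about the inner sum. *)
Lemma zero_or_over_fixpoint (x t : S) :
  x = (Over lam : S) * x + t -> zero_or_over x.
Proof.
case: x => [a|//]; rewrite {1}/GRing.mul /=.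
by case: (eqVneq a 0) => // _; case: t.
Qed.

(** For [x = Over l] the equation says that [Over l] is the join of [lam], [l] and [t], so [lam] and
    [t] lie below it; for [x = 0] it reduces to [t = 0]. *)
Lemma overflow_fixpointP (x t : S) : zero_or_over t ->
  x = (Over lam : S) * x + t <->
  [/\ ([set 0] `|` [set y | (exists l : L, y = Over l) /\ (Over lam <= y)%O]) x,
      x <> 0 -> (t <= x)%O & x = 0 -> t = 0].
Proof.
move=> zt; split=> [xE|[[->|[[l ->] lel]] tx t0]].
- have zx := zero_or_over_fixpoint _ _ xE.
  split=> [|x0|x0]; last first.
  + by move: xE; rewrite x0 mulr0 add0r.
  (* Expanding the left-hand [x] by the equation bounds each summand by [x]. *)
  + have : (x <= x)%O by [].
    rewrite {1}xE overflow_addx_le //; last exact: zero_or_over_mul_Over.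
    by case/andP.
  + case: x zx xE => [a /eqP-> _|l _ xE]; first by left.
    right; split; first by exists l.
    have : (Over l <= (Over l : S))%O by [].
    rewrite {1}xE overflow_addx_le //.
    by rewrite overflow_mul_Over /= overflow_addx_le // => /andP[/andP[]].
- by rewrite mulr0 add0r t0.
- apply: le_anti; apply/andP; split.
    case: t zt {tx t0} => [a|m] _; rewrite /Order.le /=; first exact: leUr.
    by rewrite joinAC leUr.
  rewrite overflow_addx_le ?zero_or_over_mul_Over // overflow_mul_Over /=.
  by rewrite overflow_addx_le // lel lexx tx.
Qed.

End Idempotent.

Theorem theorem3p13 (d : Order.disp_t)
  (A : posInformationAlgebraType) (L : orderType d)
  (f : powerSeries (overflow A L)) (lam : L) (f0 : f 0%N = Over lam) :
  f ^+ 2 = f <->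
  forall n : nat, (1 <= n)%N ->
    [/\ ([set 0] `|` [set x | (exists l : L, x = Over l) /\ (Over lam <= x)%O]) (f n),
        f n <> 0 ->
          exists2 s, supremums [set f i * f (n - i)%N | i in [set i | (1 <= i <= n - 1)%N]] s
                   & (s <= f n)%O
      & f n = 0 ->
          supremums [set f i * f (n - i)%N | i in [set i | (1 <= i <= n - 1)%N]] 0].
Proof.
rewrite (ps_idempotentE _ _ f0).
pose T n := \sum_(1 <= i < n) f i * f (n - i)%N.
have zT n : (forall m, (1 <= m)%N -> zero_or_over (f m)) -> zero_or_over (T n).
  move=> zf; rewrite /T big_nat_cond; apply: zero_or_over_sum => i.
  (* Both [i] and [n - i] are positive in this range, so [zf] covers both factors. *)
  by rewrite andbT => /andP[i1 iln]; apply: zero_or_overM; apply: zf; rewrite ?subn_gt0.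
have supT n : (1 <= n)%N -> (forall m, (1 <= m)%N -> zero_or_over (f m)) ->
    supremums [set f i * f (n - i)%N | i in [set i | (1 <= i <= n - 1)%N]] (T n).
  case: n => // n _ zf.
  have -> : [set i | (1 <= i <= n.+1 - 1)%N] = [set i | (1 <= i < n.+1)%N].
    by apply/seteqP; split=> i /=; rewrite subn1.
  apply: overflow_sum_sup => i /andP[i1 iln].
  by apply: zero_or_overM; apply: zf; rewrite ?subn_gt0.
split=> [fE n n1|fP n n1].
- have zf m : (1 <= m)%N -> zero_or_over (f m).
    by move=> m1; exact: zero_or_over_fixpoint _ _ _ (fE m m1).
  have [f1 f2 f3] := iffLR (overflow_fixpointP lam _ _ (zT n zf)) (fE n n1).
  split=> // [fn0|fn0]; first by exists (T n); [exact: supT|exact: f2].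
  by rewrite -(f3 fn0); exact: supT.
- have zf m : (1 <= m)%N -> zero_or_over (f m).
    by move=> /fP[[->|[[l ->] _]] _ _] //; exact: zero_or_over0.
  (* Suprema are unique, so the witness of condition (2) and the 0 of condition (3) both equal
     [T n]. *)
  have uniqT s : supremums
      [set f i * f (n - i)%N | i in [set i | (1 <= i <= n - 1)%N]] s -> s = T n.
    by move=> ss; exact: is_subset1_supremums ss (supT n n1 zf).
  have [f1 f2 f3] := fP n n1.
  apply/(overflow_fixpointP lam _ _ (zT n zf)); split=> // [/f2[s /uniqT->]|/f3/uniqT] //.
Qed.
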